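(* There exist constants $\sigma_0,\nu,\varepsilon_0>0$ and $d_0\in\mathbb{N}$ such that for all $d\ge d_0$ we have $$n^{\mathrm{ran}}(\varepsilon_0,F_{\mathrm{mon}}^d)\;>\;\nu\,\exp(\sigma_0\sqrt d),$$ and moreover, for all $d\ge d_0$ and all $\varepsilon$ with $\varepsilon_0\sqrt{d_0/d}\le\varepsilon\le\varepsilon_0$ we have $$n^{\mathrm{ran}}(\varepsilon,F_{\mathrm{mon}}^d)\;>\;\nu\,\exp\left(c\,\frac{\sqrt d}{\varepsilon}\right)\qquad\text{with } c=\sigma_0\,\varepsilon_0.$$ Specifically, for all $d\ge d_0=100$ and $\varepsilon_0=\frac1{15}$ we have $$n^{\mathrm{ran}}\left(\tfrac1{15},F_{\mathrm{mon}}^d\right)\;>\;108\cdot\exp\left(\sqrt d-\sqrt{100}\right)$$ (for $d=100$ this means $n^{\mathrm{ran}}(\frac1{15},F_{\mathrm{mon}}^{100})>108$), and for all $d\geq 100$ and all $\varepsilon$ with $\frac1{15}\sqrt{100/d}\le\varepsilon\le\frac1{15}$ we have $$n^{\mathrm{ran}}(\varepsilon,F_{\mathrm{mon}}^d)\;>\;108\cdot\exp\left(\frac{\sqrt d}{15\,\varepsilon}-\sqrt{100}\right).$$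
   Context: For $\mathbf{x},\tilde{\mathbf{x}}\in\mathbb{R}^d$ write $\mathbf{x}\le\tilde{\mathbf{x}}$ iff $x_j\le\tilde x_j$ for all $j=1,\dots,d$. Let $F_{\mathrm{mon}}^d=\{f:[0,1]^d\to[-1,1]\mid \mathbf{x}\le\tilde{\mathbf{x}}\Rightarrow f(\mathbf{x})\le f(\tilde{\mathbf{x}})\}$. The task is to approximate $f\in F_{\mathrm{mon}}^d$ in $L_1([0,1]^d)$ (Lebesgue measure) from function values. A deterministic algorithm using $n\in\mathbb{N}_0$ function values is a map $A_n=\phi\circ N:F_{\mathrm{mon}}^d\to L_1([0,1]^d)$ with $N(f)=(f(\mathbf{x}_1),\dots,f(\mathbf{x}_n))\in\mathbb{R}^n$, where the nodes may be chosen adaptively ($\mathbf{x}_i$ may depend on $f(\mathbf{x}_1),\dots,f(\mathbf{x}_{i-1})$), and $\phi:\mathbb{R}^n\to L_1([0,1]^d)$ is any map. A Monte Carlo method $A_n=(A_n^{\omega})_{\omega\in\Omega}$ is a family of such maps indexed by a random element $\omega$ of a probability space $(\Omega,\Sigma,\mathbb{P})$, with sufficient measurability for the error $$e((A_n^\omega),F_{\mathrm{mon}}^d)=\sup_{f\in F_{\mathrm{mon}}^d}\mathbb{E}\,\|A_n^{\omega}(f)-f\|_{L_1}$$ to be well defined (and Fubini's theorem to be applicable). The Monte Carlo complexity is $$n^{\mathrm{ran}}(\varepsilon,F_{\mathrm{mon}}^d)=\inf\{n\in\mathbb{N}_0\mid \exists (A_n^\omega): e((A_n^\omega),F_{\mathrm{mon}}^d)\le\varepsilon\}.$$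 *)

(* Defs.v *)
From HB Require Import structures.
From mathcomp Require Import all_boot all_order all_algebra.
From mathcomp Require Import all_classical all_reals all_analysis.
From mathcomp Require Import measurable_realfun.

Set Implicit Arguments.
Unset Strict Implicit.
Unset Printing Implicit Defensive.

Import Order.TTheory GRing.Theory Num.Theory.
Import numFieldNormedType.Exports.

Local Open Scope classical_set_scope.
Local Open Scope ring_scope.

Definition consp (T : Type) (d : nat) (p : T * d.-tuple T) : d.+1.-tuple T :=
  [tuple of p.1 :: p.2].

Lemma measurable_consp (R : realType) d :
  measurable_fun [set: measurableTypeR R * d.-tuple (measurableTypeR R)]
    (@consp (measurableTypeR R) d).
Proof. exact: measurable_cons. Qed.

Section product_step.
Context (R : realType) (d : nat).
Variable m : {sigma_finite_measure set (d.-tuple (measurableTypeR R)) -> \bar R}.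
Local Open Scope ereal_scope.

Definition lebesgue_prod (A : set (d.+1.-tuple (measurableTypeR R))) : \bar R :=
  (lebesgue_measure \x m) (@consp (measurableTypeR R) d @^-1` A).

Let lebesgue_prod0 : lebesgue_prod set0 = 0.
Proof. by rewrite /lebesgue_prod preimage_set0 measure0. Qed.

Let lebesgue_prod_ge0 A : 0 <= lebesgue_prod A.
Proof. exact: measure_ge0. Qed.

Let lebesgue_prod_sigma_additive : semi_sigma_additive lebesgue_prod.
Proof.
have mpre (A : set (d.+1.-tuple (measurableTypeR R))) : measurable A ->
    measurable (@consp (measurableTypeR R) d @^-1` A).
  by move=> mA; rewrite -[X in measurable X]setTI; exact: measurable_consp.
move=> F mF tF mUF; rewrite /lebesgue_prod preimage_bigcup.
apply: measure_semi_sigma_additive.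
- by move=> n; exact: mpre.
- apply/trivIsetP => /= i j _ _ ij; rewrite -preimage_setI.
  by move/trivIsetP : tF => /(_ _ _ _ _ ij) ->//; rewrite preimage_set0.
- by rewrite -preimage_bigcup; exact: mpre.
Qed.

HB.instance Definition _ := isMeasure.Build _ _ _ lebesgue_prod
  lebesgue_prod0 lebesgue_prod_ge0 lebesgue_prod_sigma_additive.

Let lebesgue_prod_sigma_finite : sigma_finite setT lebesgue_prod.
Proof.
have /sigma_finiteP[G [TG ndG Goo]] := sigma_finiteT (@lebesgue_measure R).
have /sigma_finiteP[F [TF ndF Foo]] := sigma_finiteT m.
exists (fun n => (@thead d _ @^-1` G n) `&`
                 ((fun x : d.+1.-tuple (measurableTypeR R) =>
                    [tuple of behead x] : d.-tuple (measurableTypeR R)) @^-1` F n)).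
  apply/seteqP; split => // x _.
  have [k _ Gk] : (\bigcup_i G i) (thead x) by rewrite -TG.
  have [l _ Fl] : (\bigcup_i F i) [tuple of behead x] by rewrite -TF.
  exists (maxn k l) => //; split.
  - by have /subsetPset := ndG _ _ (leq_maxl k l); exact.
  - by have /subsetPset := ndF _ _ (leq_maxr k l); exact.
move=> k; have [mG Gk] := Goo k; have [mF Fk] := Foo k; split.
  apply: measurableI; rewrite -[X in measurable X]setTI.
  - exact: (@measurable_tnth _ (measurableTypeR R) d.+1 ord0).
  - exact: measurable_behead.
rewrite /lebesgue_prod (_ : _ @^-1` _ = G k `*` F k).
  by rewrite product_measure1E// lte_mul_pinfty// ge0_fin_numE.
apply/seteqP; split => -[a x] /=; rewrite theadE.
- by move=> [Ga Fx]; split => //; move: Fx; congr (F k _); exact: val_inj.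
- by move=> [Ga Fx]; split => //; move: Fx; congr (F k _); exact: val_inj.
Qed.

HB.instance Definition _ := Measure_isSigmaFinite.Build _ _ _
  lebesgue_prod lebesgue_prod_sigma_finite.

End product_step.

Fixpoint borel_lebesgue (R : realType) (d : nat) :
    {sigma_finite_measure set (d.-tuple (measurableTypeR R)) -> \bar R} :=
  match d with
  | 0 => dirac [tuple]
  | d'.+1 => lebesgue_prod (borel_lebesgue R d')
  end.

Lemma borel_lebesgue_box (R : realType) (d : nat)
    (A : 'I_d -> set (measurableTypeR R)) : (forall j, measurable (A j)) ->
  let box := [set x : d.-tuple (measurableTypeR R) | forall j, A j (tnth x j)] in
  measurable box /\
  borel_lebesgue R d box = (\prod_(j < d) lebesgue_measure (A j))%E.
Proof.
elim: d A => [|d IHd] A mA box.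
  have -> : box = setT by apply/seteqP; split => // x _ [].
  by split => //; rewrite big_ord0 /= diracE in_setT.
have [mbox muE] := IHd (fun j => A (lift ord0 j)) (fun j => mA _).
split.
  rewrite (_ : box = \bigcap_(i < d.+1) ((fun x => tnth x (inord i)) @^-1` A (inord i))).
    apply: bigcap_measurable => [|i _]; first by exists 0%N.
    by rewrite -[X in measurable X]setTI; exact: measurable_tnth.
  apply/seteqP; split => x /= Ax => [i _|j]; first exact: Ax.
  by have := Ax j (ltn_ord j); rewrite /= inord_val.
rewrite big_ord_recl -muE /= /lebesgue_prod -product_measure1E//.
congr ((_ \x _)%E _); apply/seteqP; split => -[a x] /=.
  by move=> Ax; split => [|j]; [have := Ax ord0; rewrite tnth0|
    have := Ax (lift ord0 j); rewrite tnthS].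
move=> [Aa Ax] j; have [->|[k ->]] : j = ord0 \/ exists k, j = lift ord0 k.
- by case: (unliftP ord0 j) => [k ->|->]; [right; exists k|left].
- by rewrite tnth0.
- by rewrite tnthS.
Qed.

(* Monotone functions on the cube need not be Borel measurable, so the
   product measure is completed. *)
Definition lebesgue (R : realType) (d : nat) :=
  @completed_measure_extension _ _ _ (borel_lebesgue R d).
Arguments lebesgue : clear implicits.
HB.instance Definition _ (R : realType) (d : nat) :=
  Measure.on (lebesgue R d).

Lemma lebesgue_borelE (R : realType) (d : nat)
    (A : set (d.-tuple (measurableTypeR R))) :
  measurable A -> lebesgue R d A = borel_lebesgue R d A.
Proof. exact: measurable_mu_extE. Qed.

Definition cube (R : realType) (d : nat) : set (d.-tuple R) :=
  [set x | forall j : 'I_d, 0 <= tnth x j <= 1].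
Arguments cube : clear implicits.

(* Functions on [0,1]^d are represented by total functions on R^d whose values
   off the cube are irrelevant: nodes lie in the cube and integrals are over
   the cube. *)
Definition Fmon (R : realType) (d : nat) : set (d.-tuple R -> R) :=
  [set f | (forall x, cube R d x -> -1 <= f x <= 1) /\
           (forall x y, cube R d x -> cube R d y ->
              (forall j : 'I_d, tnth x j <= tnth y j) -> f x <= f y)].
Arguments Fmon : clear implicits.

(* Elements of L_1([0,1]^d) are given by representatives. *)
Definition L1 (R : realType) (d : nat) : set (d.-tuple R -> R) :=
  [set g | (lebesgue R d).-integrable (cube R d) (EFin \o g)].
Arguments L1 : clear implicits.

Definition L1dist (R : realType) (d : nat) (g f : d.-tuple R -> R) : \bar R :=
  (\int[lebesgue R d]_(x in cube R d) `|g x - f x|%:E)%E.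

(* [node y] is the next node after the values listed in [y] have been observed,
   so that the length of [y] tells which node is being chosen. *)
Record det_algorithm (R : realType) (d n : nat) := DetAlgorithm {
  node : seq R -> d.-tuple R ;
  node_cube : forall y, cube R d (node y) ;
  output : n.-tuple R -> d.-tuple R -> R ;
  output_L1 : forall y, L1 R d (output y) }.

Fixpoint info (R : realType) (d : nat) (x : seq R -> d.-tuple R)
    (f : d.-tuple R -> R) (n : nat) : n.-tuple R :=
  match n with
  | 0 => [tuple]
  | n'.+1 => let y := info x f n' in [tuple of rcons y (f (x y))]
  end.

Definition run (R : realType) (d n : nat) (A : det_algorithm R d n)
    (f : d.-tuple R -> R) : d.-tuple R -> R :=
  output A (info (node A) f n).

Section monte_carlo.
Context (R : realType) (d n : nat) (disp : measure_display)
  (Omega : measurableType disp) (P : probability Omega R).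
Local Open Scope ereal_scope.

Definition mc_dist (A : Omega -> det_algorithm R d n) (f : d.-tuple R -> R) :
  Omega -> \bar R := fun w => L1dist (run (A w) f) f.

(* The error is well defined once the distance to every input is a random
   variable; Fubini's theorem then holds for finitely supported priors on
   [Fmon R d].  No joint measurability is required. *)
Definition mc_measurable (A : Omega -> det_algorithm R d n) : Prop :=
  forall f, Fmon R d f -> measurable_fun [set: Omega] (mc_dist A f).

Definition mc_error (A : Omega -> det_algorithm R d n) : \bar R :=
  ereal_sup [set \int[P]_w mc_dist A f w | f in Fmon R d].

End monte_carlo.

(* The infimum of the empty set is +oo. *)
Definition n_ran (R : realType) (eps : R) (d : nat) : \bar R :=
  ereal_inf [set n%:R%:E | n in
    [set n : nat | exists (disp : measure_display)
       (Omega : measurableType disp) (P : probability Omega R)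
       (A : Omega -> det_algorithm R d n),
       mc_measurable A /\ (mc_error P A <= eps%:E)%E]].

(* Main.v *)
(** The argument follows the lower bound for learning monotone Boolean
    functions.  Cut the cube into [2^d] cells indexed by subsets [x] of the
    coordinates, and let [U] be a random family of [t]-subsets, each present
    independently; the function [f_U] is [1] on cell [x] if some [w] in [U]
    satisfies [w <= x], and [-1] otherwise.  Fix [x] and resample [U] on the
    [w <= x].  The pair of old and new functions is exchangeable, and they
    differ at [x] with probability [2 q (1 - q)], where [q] is the probability
    of [f_U x = -1].  Unless the algorithm notices the resampling, its outputs
    coincide and one of them is wrong at [x].  If it notices, the answer to some
    query has changed, so the first [w] in [U] (old or new) below that query
    lies below [x]; as this [w] does not depend on [x], averaging over [x]
    bounds this probability by [2 n 2^-t].  The mean error is thus at least the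
    average of [2 q (1 - q)] minus [2 n 2^-t].  Here
    [q = theta ^ 'C(|x|, t)], which for [t] of order [sqrt d / eps] stays away
    from [0] and [1] on a window of about [6 eps sqrt d] levels [|x|] around
    [d / 2], each carrying a proportion at least [2 / (3 sqrt d)] of all
    cells. *)

Require Import Defs.
From HB Require Import structures.
From mathcomp Require Import all_boot all_order all_algebra.
From mathcomp Require Import all_classical all_reals all_analysis.
From mathcomp Require Import measurable_realfun zify lra.

Import Order.TTheory GRing.Theory Num.Theory.
Import numFieldNormedType.Exports.

Local Open Scope classical_set_scope.
Local Open Scope ring_scope.

(** * Random disjunctions and adaptive queries *)

Section RandomDisjunction.
Context {R : realType} {T X : finType} (le : T -> X -> bool) (theta : R).
Implicit Types (U V : {ffun T -> bool}) (x : X).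

Definition disj U x : bool := [exists w, U w && le w x].

(** [theta] is the probability of absence, so that a disjunction is false with probability a pure
    power of [theta]. *)
Definition bern U : R := \prod_w (if U w then 1 - theta else theta).

Definition resample x U V : {ffun T -> bool} :=
  [ffun w => if le w x then V w else U w].

Lemma bern_ge0 U : 0 <= theta <= 1 -> 0 <= bern U.
Proof.
move=> /andP[? ?]; apply: prodr_ge0 => w _.
by case: ifP => _; rewrite ?subr_ge0.
Qed.

Lemma sum_bern : \sum_U bern U = 1.
Proof.
rewrite /bern -(bigA_distr_bigA (fun (_ : T) (b : bool) =>
  if b then 1 - theta else theta)).
by rewrite big1// => w _; rewrite big_bool /= subrK.
Qed.

(** The weight and the event both factor over the elements: each one below [x] contributes [theta],
    every other one contributes 1. *)
Lemma bern_avoid x : \sum_U bern U * (~~ disj U x)%:R = theta ^+ #|le^~ x|.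
Proof.
have -> : theta ^+ #|le^~ x| = \prod_w \sum_(b : bool)
    (if b then 1 - theta else theta) * (~~ (b && le w x))%:R.
  rewrite -prodr_const [RHS](bigID (le^~ x)) /= [X in _ * X]big1 ?mulr1.
    apply: eq_bigr => w lew.
    by rewrite big_bool /= (lew : le w x) mulr0 add0r mulr1.
  by move=> w /negbTE lew; rewrite big_bool /= lew !mulr1 subrK.
rewrite bigA_distr_bigA; apply: eq_bigr => U _; rewrite big_split /=.
congr (_ * _); rewrite /disj negb_exists.
have [/forallP UP|/forallPn[w]] := boolP [forall w, ~~ (U w && le w x)].
  by rewrite big1// => w _; rewrite UP.
by rewrite negbK => Uw; rewrite (bigD1 w)//= Uw mul0r.
Qed.

Lemma disj_resample x U V : disj (resample x U V) x = disj V x.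
Proof.
by apply: eq_existsb => w; rewrite ffunE; case: (le w x); rewrite ?andbT ?andbF.
Qed.

(** Exchangeability: swapping the entries below [x] between [U] and [V] is an involution on pairs
    that preserves the product weight. *)
Lemma sum_resample x (F : {ffun T -> bool} -> {ffun T -> bool} -> R) :
  \sum_U \sum_V bern U * bern V * F (resample x U V) (resample x V U) =
  \sum_U \sum_V bern U * bern V * F U V.
Proof.
pose h (p : {ffun T -> bool} * {ffun T -> bool}) :=
  (resample x p.1 p.2, resample x p.2 p.1).
have hK : involutive h.
  by move=> [U V]; congr pair; apply/ffunP => w; rewrite !ffunE; case: (le w x).
rewrite !pair_bigA /= [RHS](reindex_inj (inv_inj hK)) /=.
apply: eq_bigr => -[U V] _ /=; congr (_ * _).
rewrite /bern -!big_split /=; apply: eq_bigr => w _; rewrite !ffunE.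
by case: (le w x) => //; rewrite mulrC.
Qed.

End RandomDisjunction.

(* [q i U] is the i-th query on input [U]: two inputs told apart by [I] agree on
   some query that they answer differently. *)
Definition determined_by_queries {T X : finType} (le : T -> X -> bool)
    {K : eqType} {n : nat} (I : {ffun T -> bool} -> K)
    (q : 'I_n -> {ffun T -> bool} -> X) : Prop :=
  forall U V, I U != I V ->
    exists i, q i U = q i V /\ disj le U (q i U) != disj le V (q i U).

Section QueryLowerBound.
Context {R : realType} {T X : finType} (le : T -> X -> bool) (theta : R).
Hypothesis theta01 : 0 <= theta <= 1.
Context {K : eqType} (n : nat) (I : {ffun T -> bool} -> K)
  (q : 'I_n -> {ffun T -> bool} -> X).
Hypothesis first_difference : determined_by_queries le I q.
Implicit Types (U V : {ffun T -> bool}) (x : X).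

Local Notation bern := (bern (T := T) theta).
Local Notation resample := (resample le).
Local Notation disj := (disj le).

(* The probability that resampling all [w] below [x] changes the value at [x]
   without changing the information [I]. *)
Definition undetected x : R := \sum_U \sum_V bern U * bern V *
  ((disj U x != disj V x) && (I U == I (resample x U V)))%:R.

Let weight_ge0 U : 0 <= bern U.
Proof. exact: bern_ge0. Qed.

Lemma undetected_ge0 x : 0 <= undetected x.
Proof.
by do 2![apply: sumr_ge0 => ? _]; rewrite !mulr_ge0// ?ler0n.
Qed.

(** If the resampling goes unnoticed, the same output serves two families with opposite values 1 and
    -1 at [x], so the two errors add up to at least 2. By exchangeability both have the same
    mean. *)
Lemma undetected_le_error (g : K -> R) x :
  undetected x <= \sum_U bern U * `|g (I U) - (if disj U x then 1 else -1)|.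
Proof.
pose e U := `|g (I U) - (if disj U x then 1 else -1)|.
have E1 : \sum_U bern U * e U = \sum_U \sum_V bern U * bern V * e U.
  apply: eq_bigr => U _; rewrite -mulr_suml -mulr_sumr.
  by rewrite sum_bern mulr1.
have E2 : \sum_U bern U * e U =
    \sum_U \sum_V bern U * bern V * e (resample x U V).
  by rewrite E1 -(sum_resample le theta x (fun U V => e U)).
change (undetected x <= \sum_U bern U * e U).
suff : 2 * undetected x <= \sum_U bern U * e U + \sum_U bern U * e U by lra.
rewrite {1}E1 E2 -big_split /= /undetected mulr_sumr; apply: ler_sum => U _.
rewrite -big_split /= mulr_sumr; apply: ler_sum => V _.
rewrite -mulrDr mulrCA ler_wpM2l ?mulr_ge0//.
have [/andP[dUV /eqP IUV]|_] := boolP (_ && _); last first.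
  by rewrite mulr0 addr_ge0 ?normr_ge0.
rewrite mulr1 /e -IUV disj_resample.
have h1 : g (I U) + 1 <= `|g (I U) - -1|.
  by apply: le_trans (ler_norm _); rewrite opprK.
have h2 : 1 - g (I U) <= `|g (I U) - 1| by rewrite distrC ler_norm.
by move: dUV; case: (disj U x); case: (disj V x) => // _; lra.
Qed.

(* If resampling below [x] changes the answer to the i-th query, then every
   element of [U] (or of its resampled version) below that query is below [x],
   in particular the picked one, which does not depend on [x]. *)
Let hit i U x : bool :=
  if [pick w | U w && le w (q i U)] is Some w then le w x else false.

Let hit_resample i U V x : q i U = q i (resample x U V) -> disj U (q i U) ->
  ~~ disj (resample x U V) (q i U) -> hit i U x.
Proof.
move=> qUV /existsP[w Uw]; rewrite /hit; case: pickP => [{Uw}w /andP[Uw lew]|].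
  move=> /existsPn/(_ w); rewrite ffunE lew andbT.
  by case: (le w x); rewrite ?Uw.
by move=> /(_ w); rewrite Uw.
Qed.

Let hit_resample' i U V x : q i U = q i (resample x U V) -> ~~ disj U (q i U) ->
  disj (resample x U V) (q i U) -> hit i (resample x U V) x.
Proof.
move=> qUV; rewrite qUV /hit => /existsPn nU /existsP[w Uw].
case: pickP => [{Uw}w /andP[Uw lew]|/(_ w)]; last by rewrite Uw.
move: (nU w) Uw; rewrite lew andbT ffunE.
by case: (le w x) => // /negbTE ->.
Qed.

(** The old and new values at [x] are independent, hence differ with probability 2 q (1 - q). A
    change that is noticed produces a hit for whichever of the two families answers 1 at the
    distinguishing query; both are equally distributed, whence the factor 2. *)
Lemma undetected_ge x :
  2 * (theta ^+ #|le^~ x| * (1 - theta ^+ #|le^~ x|)) -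
    2 * \sum_U bern U * \sum_i (hit i U x)%:R <= undetected x.
Proof.
set qx := theta ^+ _.
have Eq : \sum_U bern U * (~~ disj U x)%:R = qx by exact: bern_avoid.
have Ep : \sum_U bern U * (disj U x)%:R = 1 - qx.
  apply/esym/eqP; rewrite -Eq subr_eq -big_split /=; apply/eqP.
  rewrite -[LHS](sum_bern (T := T) theta); apply: eq_bigr => U _.
  by case: (disj U x); rewrite /= ?mulr1n ?mulr0n; lra.
have -> : 2 * (qx * (1 - qx)) =
    \sum_U \sum_V bern U * bern V * (disj U x != disj V x)%:R.
  have -> : 2 * (qx * (1 - qx)) = qx * (1 - qx) + (1 - qx) * qx by lra.
  rewrite -{1}Eq -{1}Ep -{1}Ep -{1}Eq !mulr_suml -big_split /=.
  apply: eq_bigr => U _; rewrite !mulr_sumr -big_split /=.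
  apply: eq_bigr => V _; case: (disj U x); case: (disj V x);
    by rewrite /= ?(mulr1n, mulr0n); lra.
pose H U := \sum_i (hit i U x)%:R : R.
have E1 : \sum_U bern U * H U = \sum_U \sum_V bern U * bern V * H U.
  apply: eq_bigr => U _; rewrite -mulr_suml -mulr_sumr.
  by rewrite sum_bern mulr1.
have E2 : \sum_U bern U * H U =
    \sum_U \sum_V bern U * bern V * H (resample x U V).
  by rewrite E1 -(sum_resample le theta x (fun U V => H U)).
have -> : 2 * \sum_U bern U * H U =
    \sum_U bern U * H U + \sum_U bern U * H U by lra.
rewrite {1}E1 E2 -big_split /= -sumrB.
apply: ler_sum => U _; rewrite -big_split /= -sumrB; apply: ler_sum => V _.
rewrite -mulrDr -mulrBr ler_wpM2l ?mulr_ge0//.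
have H_ge0 W : 0 <= H W by apply: sumr_ge0 => i _; rewrite ler0n.
case: (disj U x != disj V x); rewrite /= ?mulr0n; last first.
  by have := H_ge0 U; have := H_ge0 (resample x U V); lra.
have [_|/first_difference[i [qUV]]] := eqVneq; rewrite /= ?(mulr1n, mulr0n).
  by have := H_ge0 U; have := H_ge0 (resample x U V); lra.
have H1 W : hit i W x -> 1 <= H W.
  by move=> h; rewrite /H (bigD1 i)//= h lerDl sumr_ge0.
case dU: (disj U _) => nUV.
  have /H1 := hit_resample _ _ _ _ qUV dU nUV.
  by have := H_ge0 (resample x U V); lra.
move: nUV; case dV: (disj (resample x U V) _) => // _.
by have /H1 := hit_resample' _ _ _ _ qUV (negbT dU) dV; have := H_ge0 U; lra.
Qed.

(** Summing over [x] first: for fixed [U] and [i] the picked element is fixed, so at most [M] points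
    are hit. *)
Lemma sum_undetected (M : nat) : (forall w, (#|le w| <= M)%N) ->
  \sum_x 2 * (theta ^+ #|le^~ x| * (1 - theta ^+ #|le^~ x|)) -
    2 * n%:R * M%:R <= \sum_x undetected x.
Proof.
move=> leM.
apply: (le_trans _ (ler_sum _ (fun x _ => undetected_ge x))).
rewrite sumrB lerB// -mulr_sumr -mulrA ler_pM2l ?ltr0n// exchange_big /=.
apply: (@le_trans _ _ (\sum_U bern U * (n%:R * M%:R))); last first.
  by rewrite -mulr_suml sum_bern mul1r.
apply: ler_sum => U _; rewrite -mulr_sumr ler_wpM2l// exchange_big /=.
apply: (@le_trans _ _ (\sum_(i < n) M%:R)); last first.
  by rewrite sumr_const card_ord mulr_natl.
apply: ler_sum => i _; rewrite -natr_sum ler_nat /hit.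
case: pickP => [w _|_]; last by rewrite big1.
rewrite (leq_trans _ (leM w))// -sum1_card [leqRHS]big_mkcond /=.
by apply: leq_sum => x _; rewrite unfold_in; case: (le w x).
Qed.

End QueryLowerBound.

(** * Numerical estimates *)

Section ExpBounds.
Context {R : realType}.
Implicit Types x a b : R.

Lemma expR_double_le x a b : expR x <= a -> a * a <= b -> expR (2 * x) <= b.
Proof.
move=> xa; apply: le_trans; rewrite expRM_natl expr2.
by rewrite ler_pM ?expR_ge0.
Qed.

Lemma expR_double_ge x a b :
  0 <= a -> a <= expR x -> b <= a * a -> b <= expR (2 * x).
Proof.
move=> a0 xa ba; apply: (le_trans ba); rewrite expRM_natl expr2.
by rewrite ler_pM.
Qed.

Lemma expR_le_invr x a : x < 1 -> 1 <= a * (1 - x) -> expR x <= a.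
Proof.
move=> x1 ax; apply: (@le_trans _ _ (1 - x)^-1).
  rewrite -[expR x]invrK -expRN lef_pV2 ?posrE ?expR_gt0 ?subr_gt0//.
  exact: expR_ge1Dx.
by rewrite -[leLHS]mul1r ler_pdivrMr ?subr_gt0.
Qed.

(* The constants below are rounded iterated squares. *)
Lemma expR1_ge : 27 / 10 <= expR 1 :> R.
Proof.
have -> : expR 1 =
    expR (2 * (2 * (2 * (2 * (2 * (2 * (2 * (1 / 128)))))))) :> R.
  by congr expR; lra.
apply: (@expR_double_ge _ (1645 / 1000 + 455 / 1000 / 1000)); [lra| |lra].
apply: (@expR_double_ge _ (1282 / 1000 + 753 / 1000 / 1000)); [lra| |lra].
apply: (@expR_double_ge _ (1132 / 1000 + 587 / 1000 / 1000)); [lra| |lra].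
apply: (@expR_double_ge _ (1064 / 1000 + 231 / 1000 / 1000)); [lra| |lra].
apply: (@expR_double_ge _ (1031 / 1000 + 616 / 1000 / 1000)); [lra| |lra].
apply: (@expR_double_ge _ (1015 / 1000 + 685 / 1000 / 1000)); [lra| |lra].
apply: (@expR_double_ge _ (1007 / 1000 + 812 / 1000 / 1000)); [lra| |lra].
by apply: le_trans (expR_ge1Dx _); lra.
Qed.

(** Here 20/11 = (6/10) / (33/100) bounds the exponent that [bin_ratio_le] yields across the
    window. *)
Lemma expR_20_11_le : expR (20 / 11) <= 7 :> R.
Proof.
have -> : 20 / 11 = 2 * (2 * (2 * (2 * (2 * (5 / 88))))) :> R by lra.
apply: (@expR_double_le _ (2549 / 1000 + 614 / 1000 / 1000)); last by lra.
apply: (@expR_double_le _ (1596 / 1000 + 751 / 1000 / 1000)); last by lra.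
apply: (@expR_double_le _ (1263 / 1000 + 626 / 1000 / 1000)); last by lra.
apply: (@expR_double_le _ (1124 / 1000 + 111 / 1000 / 1000)); last by lra.
apply: (@expR_double_le _ (1060 / 1000 + 241 / 1000 / 1000)); last by lra.
by apply: expR_le_invr; lra.
Qed.

(** The cube of exp(41/60) <= 2, the lower bound on the logarithm of 2 that [budget] relies on. *)
Lemma expR_41_20_le : expR (41 / 20) <= 8 :> R.
Proof.
have -> : 41 / 20 = 2 * (2 * (2 * (2 * (2 * (2 * (2 * (41 / 2560))))))) :> R.
  by lra.
apply: (@expR_double_le _ (2810 / 1000 + 505 / 1000 / 1000)); last by lra.
apply: (@expR_double_le _ (1676 / 1000 + 456 / 1000 / 1000)); last by lra.
apply: (@expR_double_le _ (1294 / 1000 + 780 / 1000 / 1000)); last by lra.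
apply: (@expR_double_le _ (1137 / 1000 + 884 / 1000 / 1000)); last by lra.
apply: (@expR_double_le _ (1066 / 1000 + 716 / 1000 / 1000)); last by lra.
apply: (@expR_double_le _ (1032 / 1000 + 819 / 1000 / 1000)); last by lra.
apply: (@expR_double_le _ (1016 / 1000 + 277 / 1000 / 1000)); last by lra.
by apply: expR_le_invr; lra.
Qed.

End ExpBounds.

(** * Binomial coefficients near the middle level *)

Lemma bin_doubleS_half (m : nat) : 'C(m.+1.*2, m.+1) = (2 * 'C(m.*2.+1, m))%N.
Proof.
rewrite doubleS binS mul2n -[RHS]addnn; congr addn.
by rewrite -[LHS]bin_sub; [congr 'C(_, _)|]; lia.
Qed.

Section Binomials.
Context {R : realFieldType}.

Lemma central_binS (m : nat) :
  'C(m.+1.*2, m.+1)%:R * (m%:R + 1) = 2 * (2 * m%:R + 1) * 'C(m.*2, m)%:R :> R.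
Proof.
rewrite natr1 -[2 * m%:R]natrM natr1 -!natrM; congr (_%:R).
rewrite bin_doubleS_half; have := mul_bin_diag m.*2.+1 m.
have -> : 'C(m.*2.+1, m.+1) = 'C(m.*2.+1, m).
  by rewrite -[LHS]bin_sub; [congr 'C(_, _)|]; lia.
by move=> /=; rewrite mul2n; nia.
Qed.

(** The quotient of the right side by 16^m grows with [m], by the factor (2m+1)^2 / (4m(m+1)) at
    each step; at [m = 8] it is about 0.617. *)
Lemma central_bin_ge (m : nat) : (8 <= m)%N ->
  61 / 100 * (16 : R) ^+ m <= 'C(m.*2, m)%:R ^+ 2 * (2 * m%:R).
Proof.
elim: m => // m IHm; rewrite leq_eqVlt => /predU1P[[<-]|m8].
  have -> : 'C(8.*2, 8) = (12 * 1000 + 870)%N by [].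
  by rewrite natrD natrM !exprS expr0; lra.
have {IHm} := IHm m8; have := central_binS m.
have m0 : 0 < m%:R + 1 :> R by rewrite natr1 ltr0n.
set A := 'C(_, _)%:R; set B := 'C(_, _)%:R => AB IH.
rewrite exprS -[m.+1%:R]natr1 -(ler_pM2r m0).
have -> : A ^+ 2 * (2 * (m%:R + 1)) * (m%:R + 1) = 2 * (A * (m%:R + 1)) ^+ 2.
  by lra.
rewrite {}AB; have m0' : 0 <= m%:R :> R by exact: ler0n.
have : 16 * (61 / 100 * 16 ^+ m) * (m%:R + 1) <=
    16 * (B ^+ 2 * (2 * m%:R)) * (m%:R + 1).
  by rewrite (ler_pM2r m0) ler_pM2l ?ltr0n.
have : 0 <= B ^+ 2 by rewrite sqr_ge0.
lra.
Qed.

(** For odd [d] the middle coefficient is half the central one of [d + 1], which explains the factor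
    [d + 1]; for even [d] there is slack. *)
Lemma middle_bin_ge (d : nat) : (16 <= d)%N ->
  61 / 100 * 2 ^+ d ^+ 2 <= 'C(d, d./2)%:R ^+ 2 * (d%:R + 1) :> R.
Proof.
move=> d16; have E n : 2 ^+ n ^+ 2 = 4 ^+ n :> R.
  by rewrite exprAC; congr (_ ^+ n); lra.
have E2 n : 4 ^+ n.*2 = 16 ^+ n :> R.
  by rewrite -mul2n exprM; congr (_ ^+ n); lra.
rewrite E -(odd_double_half d); set h := d./2; case: (odd d) => /=.
  have h8 : (8 <= h.+1)%N by lia.
  have := central_bin_ge _ h8; rewrite bin_doubleS_half -E2 uphalf_double.
  rewrite [4 ^+ h.+1.*2]exprS [4 ^+ _.+1]exprS natrM -!natr1 -mul2n natrM.
  lra.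
have h8 : (8 <= h)%N by lia.
rewrite add0n half_double; have := central_bin_ge _ h8; rewrite -E2.
rewrite -[in X in _ -> X](mul2n h) natrM mul2n.
have : 0 <= 'C(h.*2, h)%:R ^+ 2 :> R by rewrite sqr_ge0.
nra.
Qed.

(** Passing from level m+j to m+j+1 loses at most (m-h+2j+1)/h times ['C(d, m)]; for j < k these
    losses add up to k(k+m-h)/h. *)
Lemma bin_up_middle (d h m k : nat) :
  d = (h + m)%N -> (h <= m)%N -> (0 < h)%N -> (k <= h)%N ->
  ('C(d, m + k) <= 'C(d, m))%N /\
  'C(d, m)%:R * (h%:R - k%:R * (k%:R + m%:R - h%:R)) <=
    'C(d, m + k)%:R * h%:R :> R.
Proof.
move=> dE hm h0; elim: k => [|k IHk] kh.
  by rewrite addn0 mul0r subr0.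
have [le1 le2] := IHk (ltnW kh).
have E : ((m + k.+1) * 'C(d, m + k.+1) = (h - k) * 'C(d, m + k))%N.
  by rewrite addnS mul_bin_left dE; congr muln; lia.
have le3 : ('C(d, m + k.+1) <= 'C(d, m + k))%N.
  rewrite -(leq_pmul2l (m := m + k.+1)) ?addnS// -addnS E leq_mul2r.
  by apply/orP; right; lia.
split; first exact: leq_trans le3 le1.
have /(congr1 (GRing.natmul (1 : R))) := E.
rewrite !natrM natrD natrB 1?ltnW// -natr1.
have : 'C(d, m + k)%:R <= 'C(d, m)%:R :> R by rewrite ler_nat.
have : 'C(d, m + k.+1)%:R <= 'C(d, m + k)%:R :> R by rewrite ler_nat.
have : h%:R <= m%:R :> R by rewrite ler_nat.
have : 0 <= k%:R :> R by rewrite ler0n.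
move: le2; move: ('C(d, m)%:R) ('C(d, m + k)%:R) ('C(d, m + k.+1)%:R).
move: (h%:R) (m%:R) (k%:R) => x y z A B C BCA z0 xy CB BA E'.
have : 0 <= (y + z + 1 - x) * (B - C) by apply: mulr_ge0; lra.
have : 0 <= (y - x + 2 * z + 1) * (A - B) by apply: mulr_ge0; lra.
lra.
Qed.

(** By symmetry [l] may be taken in the upper half. With m + h = d, the loss in [bin_up_middle] is
    (l-m)(l-h)/h, where (l-m)(l-h) <= (l - d/2)^2 <= D^2/4 and h >= (d-1)/2. *)
Lemma bin_near_middle (d l : nat) (D : R) : (2 <= d)%N -> (l <= d)%N ->
  `|2 * l%:R - d%:R| <= D ->
  'C(d, d./2)%:R * (1 - D ^+ 2 / (2 * (d%:R - 1))) <= 'C(d, l)%:R.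
Proof.
move=> d2; wlog ld : l / (d <= l.*2)%N => [hw l_le_d Dl|l_le_d Dl].
  have [|/ltnW lt_d] := leqP d l.*2; first by move=> ?; exact: hw.
  rewrite -(bin_sub l_le_d); apply: hw; [lia|lia|].
  rewrite natrB// -normrN.
  by rewrite (_ : - (2 * (d%:R - l%:R) - d%:R) = 2 * l%:R - d%:R)//; lra.
set h := d./2; set m := (d - h)%N.
have h0 : (0 < h)%N by rewrite /h; lia.
have dE : d = (h + m)%N by rewrite /m /h; lia.
have hd : (d <= h.*2.+1)%N /\ (h.*2 <= d)%N by rewrite /h; split; lia.
have hm : (h <= m)%N by rewrite /m /h; lia.
have kh : (l - m <= h)%N by rewrite /m; lia.
have [_] := bin_up_middle _ _ _ _ dE hm h0 kh.
rewrite subnKC; last by lia.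
rewrite -(bin_sub (m := h)) -/m; last by lia.
set A := 'C(d, m)%:R; set B := 'C(d, l)%:R.
have A0 : 0 <= A by [].
rewrite natrB; last by lia.
have mE : m%:R = d%:R - h%:R :> R by rewrite dE natrD; lra.
have h1 : d%:R - 1 <= 2 * h%:R :> R.
  by rewrite lerBlDr -natrM natr1 ler_nat mul2n; case: hd.
have h2 : 2 * h%:R <= d%:R :> R by rewrite -natrM ler_nat mul2n; case: hd.
have l1 : d%:R <= 2 * l%:R :> R by rewrite -natrM ler_nat mul2n.
have d1 : 1 <= d%:R - 1 :> R by rewrite lerBrDr -[1 + 1]/(2%:R) ler_nat.
have {Dl} : 2 * l%:R - d%:R <= D by apply: le_trans Dl; exact: ler_norm.
rewrite mE; move: (h%:R) (l%:R) (d%:R) A B A0 h1 h2 l1 d1.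
move=> x z y A B A0 h1 h2 l1 d1 zD.
have D2 : (z - (y - x)) * (z - (y - x) + (y - x) - x) <= D ^+ 2 / 4.
  have : (2 * z - y) ^+ 2 <= D ^+ 2 by rewrite ler_pXn2r ?nnegrE//; lra.
  have : 0 <= (y - 2 * x) ^+ 2 by rewrite sqr_ge0.
  lra.
have x0 : 0 < x by lra.
move=> AB; rewrite -(ler_pM2r x0); apply: le_trans AB.
rewrite -mulrA ler_wpM2l//.
have : D ^+ 2 / 4 <= D ^+ 2 / (2 * (y - 1)) * x; last by lra.
rewrite -mulrA ler_wpM2l ?sqr_ge0// ler_pdivlMl; lra.
Qed.

End Binomials.

(** Raising the upper index from b to b+1 multiplies the coefficient by 1 + t/(b+1-t), at most
    exp(t/(a+1-t)) once b >= a. *)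
Lemma bin_ratio_le (R : realType) (a t s : nat) : (t <= a)%N ->
  'C(a + s, t)%:R <= 'C(a, t)%:R * expR (s%:R * t%:R / (a%:R + 1 - t%:R)) :> R.
Proof.
move=> ta; set c := a%:R + 1 - t%:R.
have c0 : 0 < c by rewrite /c subr_gt0 natr1 ltr_nat ltnS.
elim: s => [|s IHs]; first by rewrite addn0 !mul0r expR0 mulr1.
have := mul_bin_down (a + s).+1 t => /= /(congr1 (GRing.natmul (1 : R))).
rewrite !natrM natrB -?addnS ?leqW ?(leq_trans ta) ?leq_addr// => E.
have : 'C(a + s.+1, t)%:R <= 'C(a + s, t)%:R * expR (t%:R / c).
  have c1 : 0 < (a + s.+1)%:R - t%:R :> R.
    by rewrite subr_gt0 ltr_nat addnS ltnS (leq_trans ta)// leq_addr.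
  rewrite -(ler_pM2l c1) -E mulrCA mulrC ler_wpM2l//.
  apply: (@le_trans _ _ (((a + s.+1)%:R - t%:R) * (1 + t%:R / c))); last first.
    by rewrite ler_pM2l// expR_ge1Dx.
  have : t%:R <= ((a + s.+1)%:R - t%:R) * (t%:R / c) :> R.
    rewrite mulrCA ler_peMr// ler_pdivlMr// mul1r /c addnS -natr1 natrD.
    by have : 0 <= s%:R :> R by []; lra.
  lra.
move/le_trans; apply.
rewrite -[s.+1%:R]natr1 mulrDl mul1r mulrDl expRD mulrA ler_wpM2r//.
Qed.

(** * The window of levels around the middle and the query budget *)

Section Window.
Context {R : realType}.

Lemma ler_of_sqr (x y : R) : 0 <= y -> x * x <= y * y -> x <= y.
Proof. by move=> y0; rewrite !leNgt; apply: contraNN => yx; nra. Qed.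

Lemma ltr_of_sqr (x y : R) : 0 <= y -> x * x < y * y -> x < y.
Proof. by move=> y0; rewrite !ltNge; apply: contraNN => yx; nra. Qed.

Lemma level_ge (d l : nat) : (100 <= d)%N -> (l <= d)%N ->
  `|2 * l%:R - d%:R| <= Num.sqrt d%:R / 2 :> R ->
  2 / 3 * 2 ^+ d <= Num.sqrt d%:R * 'C(d, l)%:R :> R.
Proof.
move=> d100 ld Dl; set r := Num.sqrt d%:R.
have r0 : 0 <= r :> R by exact: sqrtr_ge0.
have r2 : r ^+ 2 = d%:R :> R by rewrite sqr_sqrtr.
have d100R : 100 <= d%:R :> R by rewrite ler_nat.
have d2 : (2 <= d)%N by lia.
have := bin_near_middle _ _ _ d2 ld Dl; have := middle_bin_ge (R := R) d.
move=> /(_ ltac:(lia)); rewrite expr_div_n r2.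
move: (exprn_ge0 d (ler0n R 2)) (ler0n R 'C(d, d./2)).
move: ('C(d, d./2)%:R) ('C(d, l)%:R).
move: (2 ^+ d) => P A B P0 A0 AP AB.
(* The square of 0.777 is just below (61/100)(100/101), the worst case being [d = 100]. *)
have h1 : 777 / 1000 * P <= r * A.
  apply: ler_of_sqr; first exact: mulr_ge0.
  have -> : r * A * (r * A) = d%:R * A ^+ 2 by rewrite -r2; lra.
  rewrite -(@ler_pM2r _ (d%:R + 1)); last by lra.
  have : 61 / 100 * P ^+ 2 * d%:R <= A ^+ 2 * (d%:R + 1) * d%:R.
    by rewrite ler_wpM2r.
  have : 0 <= P ^+ 2 * (d%:R - 100) by rewrite mulr_ge0 ?sqr_ge0//; lra.
  have : 0 <= P ^+ 2 by rewrite sqr_ge0.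
  lra.
(* At [d = 100] the right side is 1 - 100/792; the product of 0.8737 and 0.777 still exceeds 2/3. *)
have h2 : 8737 / 10000 <= 1 - d%:R / 2 ^+ 2 / (2 * (d%:R - 1)) :> R.
  rewrite lerBrDr -lerBrDl ler_pdivrMr; lra.
have : A * (8737 / 10000) <= B by apply: le_trans AB; rewrite ler_wpM2l.
move=> /(ler_wpM2l r0); lra.
Qed.

Lemma nat_floor (x : R) : 0 <= x ->
  exists2 n : nat, n%:R <= x & x < n%:R + 1.
Proof.
by move=> /truncn_itv/andP[? ?]; exists (Num.truncn x); rewrite ?natr1.
Qed.

Lemma half_window (d s : nat) : (s <= d)%N ->
  (d <= 2 * (d - s)./2 + 1 + s)%N /\ (2 * (d - s)./2 + s <= d)%N.
Proof. by lia. Qed.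

(* With [Y = eps sqrt d], the window has about [6 Y] levels around [d / 2], and
   [t] about [d / (10 Y)] keeps the expected number of terms below a point
   constant up to a factor 7 across the window. *)
Lemma window (d : nat) (eps : R) : (100 <= d)%N ->
  2 / 3 <= eps * Num.sqrt d%:R -> eps <= 1 / 15 ->
  exists (t s a : nat),
  [/\ (t <= a)%N /\ (a + s <= d)%N,
      'C(a + s, t)%:R <= 7 * 'C(a, t)%:R :> R,
      forall l, (a <= l <= a + s)%N ->
        2 / 3 * 2 ^+ d <= Num.sqrt d%:R * 'C(d, l)%:R :> R,
      6 * (eps * Num.sqrt d%:R) <= s%:R + 1 &
      Num.sqrt d%:R / (10 * eps) <= t%:R + 1].
Proof.
move=> d100; set r := Num.sqrt d%:R => Y1 eps15.
have r2 : r * r = d%:R by rewrite -expr2 sqr_sqrtr.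
have d100R : 100 <= d%:R :> R by rewrite ler_nat.
have r10 : 10 <= r.
  have -> : 10 = Num.sqrt (10 ^+ 2) :> R by rewrite sqrtr_sqr ger0_norm.
  by rewrite ler_wsqrtr//; lra.
have eps0 : 0 < eps by rewrite -(pmulr_lgt0 _ (_ : 0 < r)); lra.
have r_10d : r <= d%:R / 10 by nra.
have [t t1 t2] : exists2 t : nat,
    t%:R <= r / (10 * eps) & r / (10 * eps) < t%:R + 1.
  by apply: nat_floor; apply: divr_ge0; lra.
have [s s1 s2] : exists2 s : nat,
    s%:R <= 6 * (eps * r) & 6 * (eps * r) < s%:R + 1.
  by apply: nat_floor; lra.
have t3 : t%:R * (10 * (eps * r)) <= d%:R.
  by move: t1; rewrite ler_pdivlMr; [nra|lra].
have s0 : 0 <= s%:R :> R by []. have t0 : 0 <= t%:R :> R by [].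
have st : s%:R * t%:R <= 6 / 10 * d%:R :> R.
  have : s%:R * t%:R <= 6 * (eps * r) * t%:R by rewrite ler_wpM2r.
  lra.
have t4 : t%:R <= 15 / 100 * d%:R :> R.
  have : 0 <= t%:R * (eps * r - 2 / 3) by rewrite mulr_ge0 ?subr_ge0.
  lra.
have s3 : s%:R <= 4 / 10 * r.
  have : 0 <= (1 / 15 - eps) * r by apply: mulr_ge0; lra.
  lra.
have sd : (s <= d)%N by rewrite -(ler_nat R); lra.
have [a1 a2] := half_window _ _ sd.
exists t, s, (d - s)./2; move: ((d - s)./2) a1 a2 => a a1 a2.
have a2' := a2.
rewrite -(ler_nat R) 2!natrD natrM in a1.
rewrite -(ler_nat R) natrD natrM in a2.
(* [a] is about (d-s)/2, with s <= 4d/100 and t <= 15d/100: 50 - 2 - 15 = 33. *)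
have at33 : 33 / 100 * d%:R <= a%:R + 1 - t%:R :> R by lra.
have ta : (t <= a)%N by rewrite -ltnS -(ltr_nat R) -natr1; lra.
split=> //; last 2 first.
- exact: ltW.
- exact: ltW.
- by split=> //; clear -a2' sd; lia.
- apply: (le_trans (@bin_ratio_le R a t s ta)); rewrite mulrC ler_wpM2r//.
  apply: le_trans expR_20_11_le; rewrite ler_expR ler_pdivrMr; lra.
(* In the window |2l - d| <= s + 1 <= 4r/10 + 1 <= r/2, because r >= 10. *)
- move=> l /andP[al la]; apply: level_ge => //; first by clear -a2' la sd; lia.
  rewrite -(ler_nat R) in al; rewrite -(ler_nat R) natrD in la.
  by rewrite -/r ler_norml; lra.
Qed.

(** Put X = r/(15 eps). Then t + 1 >= 3X/2 makes 2^(t+1) at least exp(41X/40), while [n] is at most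
    of order exp(X). The surplus exp(X/40) absorbs the factor [eps], which is at least of order
    1/sqrt(X) since (15 eps)^2 X = 15 eps r >= 10. *)
Lemma budget (d n t : nat) (eps : R) : (100 <= d)%N ->
  2 / 3 <= eps * Num.sqrt d%:R -> eps <= 1 / 15 ->
  Num.sqrt d%:R / (10 * eps) <= t%:R + 1 ->
  n%:R <= 108 * expR (Num.sqrt d%:R / (15 * eps) - 10) ->
  2 * n%:R / 2 ^+ t < 28 / 100 * eps.
Proof.
move=> d100; set r := Num.sqrt d%:R => Y1 eps15 tX.
have r2 : r * r = d%:R by rewrite -expr2 sqr_sqrtr.
have d100R : 100 <= d%:R :> R by rewrite ler_nat.
have r0 : 0 <= r by exact: sqrtr_ge0.
have eps0 : 0 < eps by nra.
set X := r / (15 * eps).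
have XE : X * (15 * eps) = r by rewrite /X divfK//; lra.
have X0 : 0 < X by nra.
have tX' : 3 / 2 * X <= t%:R + 1.
  by apply: le_trans tX; rewrite ler_pdivlMr; lra.
have two_t : expR (41 / 40 * X) <= 2 * 2 ^+ t.
  have -> : 41 / 40 * X = (41 / 60) * (3 / 2 * X) by lra.
  have e2 : expR (41 / 60) <= 2 :> R.
    rewrite leNgt; apply/negP => e2; have : 2 ^+ 3 < expR (41 / 60) ^+ 3 :> R.
      by rewrite ltrXn2r.
    apply/negP; rewrite -leNgt.
    rewrite -expRM_natl (_ : 3%:R * (41 / 60) = 41 / 20); last by lra.
    by apply: (le_trans expR_41_20_le); rewrite !exprS expr0; lra.
  apply: (@le_trans _ _ (expR (41 / 60) ^+ t.+1)).
    by rewrite -expRM_natl ler_expR -natr1; lra.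
  by rewrite -exprS ler_pXn2r// ?nnegrE ?expR_ge0.
move=> nX; rewrite ltr_pdivrMr ?exprn_gt0//.
have {nX} : n%:R * expR 10 <= 108 * expR X.
  by move: nX; rewrite expRB mulrA ler_pdivlMr ?expR_gt0.
set E := expR (X / 40).
have EE : expR (41 / 40 * X) = expR X * E by rewrite -expRD; congr expR; lra.
have E0 : 0 < E by exact: expR_gt0.
(* The tangent inequality u <= exp(u-1) at u = X/20. *)
have XE2 : X * expR 1 <= 20 * E ^+ 2.
  have : X / 20 <= expR (X / 20 - 1) by apply: le_trans (expR_ge1Dx _); lra.
  rewrite expRB ler_pdivlMr ?expR_gt0// /E -expRM_natl.
  rewrite (_ : 2 * (X / 40) = X / 20); last by lra.
  lra.
have e1 := @expR1_ge R.
have e10 : expR 10 = expR 1 ^+ 10 :> R by rewrite -expRM_natl mulr1.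
have epsX : 10 <= 15 * eps * (15 * eps) * X.
  have -> : 15 * eps * (15 * eps) * X = 15 * eps * r by rewrite -XE; lra.
  lra.
(* 432 = 2 * 2 * 108: one 2 comes from [2 * n], the other from 2^t >= exp(X) E / 2. Squaring
   replaces E^2 by a multiple of X, after which [eps] and [X] enter only through the product bounded
   in [epsX]. *)
have key : 432 < 28 / 100 * eps * E * expR 10.
  have e0 : 0 < expR 10 :> R by exact: expR_gt0.
  apply: ltr_of_sqr; first by rewrite !mulr_ge0 ?ltW//; lra.
  have y10 : 20 * 1000 + 586 <= expR 10 :> R.
    rewrite e10; have y5 : 143 + 48 / 100 <= expR 1 ^+ 5 :> R.
      apply: (@le_trans _ _ ((27 / 10) ^+ 5)).
        by rewrite !exprS expr0; lra.
      by rewrite lerXn2r// nnegrE ?expR_ge0//; lra.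
    rewrite -[10%N]/(5 + 5)%N exprD.
    apply: (@le_trans _ _ ((143 + 48 / 100) * (143 + 48 / 100))); first by lra.
    by apply: (ler_pM _ _ y5 y5); lra.
  have e21 : 1143 * 1000 * 1000 <= expR 1 * (expR 10 * expR 10) :> R.
    have yy : (20 * 1000 + 586) * (20 * 1000 + 586) <= expR 10 * expR 10 :> R.
      by apply: (ler_pM _ _ y10 y10); lra.
    apply: (@le_trans _ _ (27 / 10 * ((20 * 1000 + 586) * (20 * 1000 + 586)))).
      by lra.
    by apply: (ler_pM _ _ e1 yy); lra.
  set Z := expR 10 * expR 10 in e21 *.
  have [c c0 cE] : exists2 c : R, 0 <= c & c = 28 / 100 / 15.
    by exists (28 / 100 / 15); lra.
  have -> : 28 / 100 * eps * E * expR 10 * (28 / 100 * eps * E * expR 10) =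
      c * c * (15 * eps * (15 * eps)) * E ^+ 2 * Z by rewrite /Z cE; lra.
  have U0 : 0 <= 15 * eps * (15 * eps) by rewrite -expr2 sqr_ge0.
  have Z0 : 0 <= Z by rewrite mulr_ge0 ?expR_ge0.
  have W0 : 0 <= expR 1 * Z by rewrite mulr_ge0 ?expR_ge0.
  move: (15 * eps * (15 * eps)) U0 epsX => U U0 UX.
  have cU0 : 0 <= c * c * U * Z by rewrite !mulr_ge0.
  have s1 := ler_wpM2l cU0 XE2.
  have s2 := ler_wpM2l (mulr_ge0 c0 c0) (ler_wpM2r W0 UX).
  have s3 : 432 * 432 * 20 < c * c * (10 * (expR 1 * Z)).
    rewrite cE; move: (expR 1 * Z) e21 => W WZ; lra.
  move: (E ^+ 2) (expR 1) s1 s2 s3 => F y s1 s2 s3.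
  clear -s1 s2 s3; lra.
move=> nX.
have e10_0 : 0 < expR 10 :> R by exact: expR_gt0.
have eX : 0 < expR X by exact: expR_gt0.
rewrite -(ltr_pM2r e10_0).
apply: (@le_lt_trans _ _ (216 * expR X)); first by lra.
apply: (@lt_le_trans _ _ (28 / 100 * eps * (expR X * E / 2) * expR 10)).
  have := ltr_pM2r eX 432 (28 / 100 * eps * E * expR 10).
  by rewrite key; lra.
rewrite ler_pM2r// ler_pM2l//; last by lra.
by rewrite -EE; lra.
Qed.
End Window.

(** * The Boolean cube *)

Section BooleanCube.
Context {R : realType} {d : nat}.
Implicit Types w x : {set 'I_d}.

(** With the size condition inside the relation, families range over all subsets; those of size
    other than [t] lie below no point and never affect a disjunction. *)
Definition term_le (t : nat) w x : bool := (w \subset x) && (#|w| == t).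

Lemma card_term_le (t : nat) x : #|(term_le t)^~ x| = 'C(#|x|, t).
Proof. by rewrite -cards_draws; apply: eq_card => w; rewrite inE. Qed.

(** Complementation maps the sets above [w] to subsets of its complement, which has d - t
    elements. *)
Lemma card_above_term (t : nat) w : (#|term_le t w| <= 2 ^ (d - t))%N.
Proof.
have [<-|nwt] := eqVneq #|w| t; last first.
  by rewrite eq_card0// => x; rewrite unfold_in /term_le (negbTE nwt) andbF.
have -> : (d - #|w|)%N = #|finset.setC w|.
  by rewrite [RHS]cardsCs finset.setCK card_ord.
rewrite -card_powerset.
rewrite -(card_imset (mem (term_le #|w| w)) (@finset.setC_inj 'I_d)).
apply: subset_leq_card; apply/fintype.subsetP => y /imsetP[x].
rewrite unfold_in.
by move=> /andP[wx _] ->; rewrite powersetE finset.setCS.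
Qed.

Lemma sum_levels (F : nat -> R) :
  \sum_(x : {set 'I_d}) F #|x| = \sum_(l < d.+1) 'C(d, l)%:R * F l.
Proof.
rewrite (partition_big (fun x : {set 'I_d} => inord #|x| : 'I_d.+1) xpredT)//=.
have cardx (x : {set 'I_d}) : (#|x| < d.+1)%N.
  by rewrite ltnS -[leqRHS]card_ord max_card.
apply: eq_bigr => l _.
rewrite (eq_bigl (mem (finset (fun x : {set 'I_d} => #|x| == l)))); last first.
  by move=> x; rewrite /= inE -val_eqE /= inordK.
rewrite (eq_bigr (fun=> F l)); last by move=> x; rewrite !inE => /eqP ->.
by rewrite sumr_const card_draws card_ord mulr_natl.
Qed.

(** Used with [C] the number of terms below a point at the bottom of the window. As (4/5)^7 >= 1/5,
    a sevenfold growth of that number keeps the probability of value -1 between 1/5 and 4/5. *)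
Lemma root_4_5 (C : nat) : (0 < C)%N ->
  exists2 theta : R, 0 <= theta <= 1 & theta ^+ C = 4 / 5.
Proof.
move=> C0; have CR : C%:R != 0 :> R by rewrite pnatr_eq0 -lt0n.
have E : expR (ln (4 / 5) / C%:R) ^+ C = 4 / 5 :> R.
  by rewrite -expRM_natl mulrC divfK// lnK// posrE; lra.
exists (expR (ln (4 / 5) / C%:R)) => //; rewrite expR_ge0 /= leNgt.
apply/negP => h; have : 1 < (4 / 5 : R) by rewrite -E exprn_egt1// -lt0n.
lra.
Qed.

Lemma undetected_lower_bound (eps : R) : (100 <= d)%N ->
  2 / 3 <= eps * Num.sqrt d%:R -> eps <= 1 / 15 ->
  exists (t : nat) (theta : R), 0 <= theta <= 1 /\ forall n : nat,
    n%:R <= 108 * expR (Num.sqrt d%:R / (15 * eps) - 10) ->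
    exists2 c : R, eps < c & forall (K : eqType)
      (I : {ffun {set 'I_d} -> bool} -> K)
      (q : 'I_n -> {ffun {set 'I_d} -> bool} -> {set 'I_d}),
      determined_by_queries (term_le t) I q ->
      c * 2 ^+ d <= \sum_x undetected (term_le t) theta I x.
Proof.
move=> d100 Y1 eps15.
have [t [s [a [[ta asd] C7 mass sY tX]]]] := window _ _ d100 Y1 eps15.
have Ca0 : (0 < 'C(a, t))%N by rewrite bin_gt0.
have [theta th01 thE] := root_4_5 _ Ca0.
exists t, theta; split=> // n nX.
have nt := budget _ _ _ _ d100 Y1 eps15 tX nX.
(* 1.28 = 6 * (2/3) * 0.32: at least 6 eps r levels, each with a proportion at least 2/(3r) of the
   cells, each cell contributing 2q(1-q) >= 0.32 for q between 1/5 and 4/5. Detection costs less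
   than 0.28 eps. *)
exists (128 / 100 * eps - 2 * n%:R / 2 ^+ t); first by lra.
move=> K I q fd.
apply: le_trans (sum_undetected _ _ th01 _ _ _ fd _ (card_above_term t)).
have P0 : 0 < 2 ^+ d :> R by rewrite exprn_gt0.
have -> : 2 * n%:R * (2 ^ (d - t))%:R = 2 * n%:R / 2 ^+ t * 2 ^+ d :> R.
  have td : (t <= d)%N by rewrite (leq_trans ta)// (leq_trans _ asd)// leq_addr.
  have -> : 2 ^+ d = 2 ^+ t * 2 ^+ (d - t) :> R by rewrite -exprD subnKC.
  by rewrite natrX mulrA divfK// expf_neq0.
rewrite mulrBl lerB//.
under eq_bigr do rewrite card_term_le.
pose v l := 2 * (theta ^+ 'C(l, t) * (1 - theta ^+ 'C(l, t))).
rewrite (sum_levels v).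
have [th0 th1] := andP th01.
have v_ge l : (a <= l <= a + s)%N -> 32 / 100 <= v l.
  move=> /andP[al la]; rewrite /v.
  have : theta ^+ 'C(l, t) <= 4 / 5.
    by rewrite -thE; apply: ler_wiXn2l => //; exact: leq_bin2l.
  have : 1 / 5 <= theta ^+ 'C(l, t).
    apply: (@le_trans _ _ (theta ^+ (7 * 'C(a, t)))).
      by rewrite mulnC exprM thE !exprS expr0; lra.
    apply: ler_wiXn2l => //; apply: leq_trans (leq_bin2l t la) _.
    by rewrite -(ler_nat R) natrM.
  move: (theta ^+ _) => y y1 y2; nra.
have v_ge0 l : 0 <= v l.
  by rewrite !mulr_ge0 ?exprn_ge0 ?subr_ge0// exprn_ile1.
set r := Num.sqrt d%:R in Y1 mass sY *.
have r0 : 0 < r by rewrite sqrtr_gt0 ltr0n; lia.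
pose m := 2 / 3 * 2 ^+ d / r.
have mE : m * r = 2 / 3 * 2 ^+ d by rewrite divfK// gt_eqF.
apply: (@le_trans _ _ (\sum_(a <= l < (a + s).+1) m * (32 / 100))).
  rewrite sumr_const_nat subSn ?leq_addr// addKn -mulr_natl -natr1.
  rewrite -(ler_pM2r r0).
  have : 6 * (eps * r) * (m * r) <= (s%:R + 1) * (m * r).
    by rewrite ler_wpM2r// mE; lra.
  rewrite {1}mE; lra.
rewrite -(big_mkord xpredT (fun l => 'C(d, l)%:R * v l)) /=.
have ad : (a <= (a + s).+1)%N by rewrite -addnS leq_addr.
rewrite (big_cat_nat (leq0n a)) /=; last by lia.
rewrite [X in _ <= _ + X](big_cat_nat ad)//=.
rewrite -[leLHS]add0r lerD//; last rewrite -[leLHS]addr0 lerD//.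
- by apply: sumr_ge0 => l _; rewrite mulr_ge0.
- apply: ler_sum_nat => l al; apply: ler_pM; [|by lra| |exact: v_ge].
    by rewrite /m divr_ge0// ?ltW//; lra.
  by rewrite ler_pdivrMr// [_ * r]mulrC mass.
- by apply: sumr_ge0 => l _; rewrite mulr_ge0.
Qed.

End BooleanCube.

(** * From cells to Lebesgue measure *)

(** Serves twice as the exchange of prior and integral: over the points of the cube, then over the
    randomness of the method. *)
Lemma integral_le_weighted_sum (dsp : measure_display) (T : measurableType dsp)
    (R : realType) (mu : {measure set T -> \bar R}) (D : set T) (I : finType)
    (p : I -> R) (F : I -> T -> \bar R) (G : T -> \bar R) :
  measurable D -> (forall i, 0 <= p i) ->
  (forall i, measurable_fun D (F i)) ->
  (forall i z, D z -> (0 <= F i z)%E) ->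
  measurable_fun D G -> (forall z, D z -> (0 <= G z)%E) ->
  (forall z, D z -> (G z <= \sum_i (p i)%:E * F i z)%E) ->
  (\int[mu]_(z in D) G z <= \sum_i (p i)%:E * \int[mu]_(z in D) F i z)%E.
Proof.
move=> mD p0 mF F0 mG G0 GF.
have mpF i : measurable_fun D (fun z => (p i)%:E * F i z)%E.
  by apply: emeasurable_funM => //; exact: measurable_cst.
have pF0 i z : D z -> (0 <= (p i)%:E * F i z)%E.
  by move=> Dz; rewrite mule_ge0 ?lee_fin ?F0.
rewrite [leRHS](eq_bigr (fun i => \int[mu]_(z in D) ((p i)%:E * F i z))%E).
  rewrite -(ge0_integral_sum mu mD mpF)//; apply: ge0_le_integral => //.
  exact: emeasurable_sum.
by move=> i _; rewrite ge0_integralZl_EFin// => z; exact: F0.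
Qed.

Section Cells.
Context {R : realType} {d : nat}.
Implicit Types (x : {set 'I_d}) (z : d.-tuple R).

Definition cell z : {set 'I_d} := finset (fun j => 2^-1 <= tnth z j).

Definition cell_set x : set (d.-tuple R) := [set z | cube R d z /\ cell z = x].

Local Notation ctype :=
  (caratheodory_type (mu_ext (borel_lebesgue R d))).

Lemma cell_set_measure x :
  measurable (cell_set x : set ctype) /\
  lebesgue R d (cell_set x) = (2 ^- d)%:E.
Proof.
pose A (j : 'I_d) : set (measurableTypeR R) :=
  if j \in x then `[2^-1, 1]%classic else `[0, 2^-1[%classic.
have mA j : measurable (A j).
  by rewrite /A; case: ifP => _; exact: measurable_itv.
have lA j : lebesgue_measure (A j) = (2^-1)%:E.
  rewrite /A; case: ifP => _; rewrite lebesgue_measure_itv /= lte_fin ifT.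
  - by rewrite -EFinD; congr EFin; lra.
  - by rewrite invf_lt1// ltr1n.
  - by rewrite sube0.
  - by rewrite invr_gt0.
have [] := @borel_lebesgue_box R d A mA.
have -> : [set z | forall j, A j (tnth z j)] = cell_set x.
  apply/seteqP; split=> z /=.
    move=> Az; split.
      move=> j; move: (Az j); rewrite /A; case: ifP => _; rewrite /= in_itv /=.
        by move=> /andP[? ->]; rewrite andbT (le_trans _ (_ : 2^-1 <= _)).
      move=> /andP[-> ?].
      by rewrite /= (le_trans (ltW _) (_ : 2^-1 <= 1))//; lra.
    apply/setP => j; rewrite inE; move: (Az j); rewrite /A; case: ifP => _;
      rewrite /= in_itv /= => /andP[] //.
    by move=> _; rewrite ltNge => /negbTE.
  move=> [cz cE] j; rewrite /A -cE inE; have /andP[z0 z1] := cz j.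
  by case: ifP => h; rewrite /= in_itv /= ?z0 ?z1 ?h// ltNge h.
move=> mcell cellE; split; first exact: caratheodory_measurable_mu_ext.
rewrite lebesgue_borelE// cellE (eq_bigr (fun=> (2^-1)%:E)); last by move=> j _.
by rewrite prodEFin prodr_const card_ord exprVn.
Qed.

Lemma cube_cells :
  cube R d = \big[setU/set0]_(x <- index_enum {set 'I_d}) cell_set x.
Proof.
rewrite -bigcup_seq; apply/seteqP; split=> z.
  by move=> cz; exists (cell z) => //=; rewrite mem_index_enum.
by move=> [x _ []].
Qed.

Lemma measurable_cube : measurable (cube R d : set ctype).
Proof.
rewrite cube_cells; apply: bigsetU_measurable => x _.
by case: (cell_set_measure x).
Qed.

(** The preimage of any set whatsoever is a finite union of cells. *)
Lemma measurable_cell (h : {set 'I_d} -> R) :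
  measurable_fun (cube R d : set ctype) (h \o cell).
Proof.
move=> _ Y _; have -> : cube R d `&` (h \o cell) @^-1` Y =
    \bigcup_(x in [set x | Y (h x)]) cell_set x.
  apply/seteqP; split=> z.
    by move=> [cz Yz]; exists (cell z).
  by move=> [x Yx [cz zx]]; split=> //=; rewrite zx.
apply: fin_bigcup_measurable; first exact: finite_finset.
by move=> x _; case: (cell_set_measure x).
Qed.

Lemma integral_cell (h : {set 'I_d} -> R) : (forall x, 0 <= h x) ->
  (\int[lebesgue R d]_(z in cube R d) (h (cell z))%:E =
   (2 ^- d * \sum_x h x)%:E)%E.
Proof.
move=> h0; rewrite cube_cells ge0_integral_bigsetU//=.
- rewrite mulr_sumr -sumEFin; apply: eq_bigr => x _.
  have [mx lx] := cell_set_measure x.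
  rewrite (eq_integral (cst (h x)%:E)) ?integral_cst//.
    by rewrite [X in (_ * X)%E]lx mulrC.
  by move=> z; rewrite inE => -[_ ->].
- by move=> x; case: (cell_set_measure x).
- exact: index_enum_uniq.
- by move=> x y _ _ [z [[_ <-] [_ <-]]].
- by rewrite -cube_cells; apply/measurable_EFinP; exact: measurable_cell.
- by move=> z _; rewrite lee_fin.
Qed.

End Cells.

(** * Algorithms *)

(** At the first differing answer the data collected so far agree, so both runs visit the same
    node. *)
Lemma info_first_difference (R : realType) (d : nat) (x : seq R -> d.-tuple R)
    (f g : d.-tuple R -> R) (n : nat) : info x f n != info x g n ->
  exists i : 'I_n,
    info x f i = info x g i /\ f (x (info x f i)) != g (x (info x f i)).
Proof.
elim: n => [|n IHn]; first by move=> /eqP[].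
have [E|/IHn[i [E fg]] _] := eqVneq (info x f n) (info x g n); last first.
  by exists (widen_ord (leqnSn n) i).
move=> ne; exists ord_max; split; first exact: E.
by apply: contraNneq ne => fg; apply/eqP/val_inj; rewrite /= -E fg.
Qed.

Section Prior.
Context {R : realType} {d : nat} (t : nat).
Implicit Types (U : {ffun {set 'I_d} -> bool}) (z : d.-tuple R).

Definition prior_fun U z : R := if disj (term_le t) U (cell z) then 1 else -1.

Lemma prior_fun_Fmon U : Fmon R d (prior_fun U).
Proof.
split=> [z _|y z _ _ yz]; rewrite /prior_fun.
  by case: ifP => _; apply/andP; split; lra.
have [/existsP[w /and3P[Uw wy wt]]|_] := boolP (disj _ U (cell y)); last first.
  by case: ifP => _; lra.
rewrite ifT//; apply/existsP; exists w; rewrite Uw /term_le wt andbT.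
apply: (fintype.subset_trans wy); apply/fintype.subsetP => j; rewrite !inE.
by move/le_trans; apply.
Qed.

Let query n (A : det_algorithm R d n) (i : 'I_n) U :=
  cell (node A (info (node A) (prior_fun U) i)).

Let info_determined n (A : det_algorithm R d n) :
  determined_by_queries (term_le t)
    (fun U => info (node A) (prior_fun U) n) (query n A).
Proof.
move=> U V /info_first_difference[i [E ne]].
exists i; rewrite /query -E; split=> //.
by apply: contraNneq ne; rewrite /prior_fun => ->.
Qed.

(** At a fixed point [z] the output is a function of the information alone, so [undetected_le_error]
    applies pointwise; integrating over the cells then averages [undetected]. *)
Lemma det_error_ge (theta c : R) n (A : det_algorithm R d n) :
  0 <= theta <= 1 ->
  (forall (K : eqType) (I : {ffun {set 'I_d} -> bool} -> K)
      (q : 'I_n -> {ffun {set 'I_d} -> bool} -> {set 'I_d}),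
      determined_by_queries (term_le t) I q ->
      c * 2 ^+ d <= \sum_x undetected (term_le t) theta I x) ->
  (c%:E <= \sum_U (bern theta U)%:E *
     L1dist (run A (prior_fun U)) (prior_fun U))%E.
Proof.
move=> th01 /(_ _ _ _ (info_determined _ A)).
set u := undetected _ _ _ => cu.
apply: (@le_trans _ _ (2 ^- d * \sum_x u x)%:E).
  by rewrite lee_fin mulrC ler_pdivlMr// exprn_gt0.
have u0 x : 0 <= u x by exact: undetected_ge0.
rewrite -(integral_cell _ u0).
apply: integral_le_weighted_sum.
- exact: measurable_cube.
- by move=> U; exact: bern_ge0.
- move=> U; apply/measurable_EFinP.
  apply: measurableT_comp (@normr_measurable R setT) _.
  apply: measurable_funB.
    by apply/measurable_EFinP; apply: measurable_int; exact: output_L1.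
  exact: (measurable_cell (fun x => if disj (term_le t) U x then 1 else -1)).
- by move=> U z _; rewrite lee_fin.
- by apply/measurable_EFinP; exact: measurable_cell.
- by move=> z _; rewrite lee_fin.
move=> z _; under eq_bigr do rewrite -EFinM.
rewrite sumEFin lee_fin.
exact: (undetected_le_error _ _ th01 _ (fun y => output A y z)).
Qed.

(** Averaging argument: the prior does not depend on [w], so the deterministic bound holds for every
    realization, and the worst-case error dominates the mean over the prior. *)
Lemma mc_error_gt (theta eps c : R) n disp (Omega : measurableType disp)
    (P : probability Omega R) (A : Omega -> det_algorithm R d n) :
  0 <= theta <= 1 -> eps < c ->
  (forall (K : eqType) (I : {ffun {set 'I_d} -> bool} -> K)
      (q : 'I_n -> {ffun {set 'I_d} -> bool} -> {set 'I_d}),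
      determined_by_queries (term_le t) I q ->
      c * 2 ^+ d <= \sum_x undetected (term_le t) theta I x) ->
  0 <= c -> mc_measurable A -> (eps%:E < mc_error P A)%E.
Proof.
move=> th01 eps_c cu c0 mA.
apply: (@lt_le_trans _ _ c%:E); first by rewrite lte_fin.
have -> : c%:E = (\int[P]_w (cst c%:E w))%E.
  rewrite integral_cst// -[LHS]mule1; congr (_ * _)%E.
  by apply/esym; exact: (probability_setT P).
apply: (@le_trans _ _ (\sum_U (bern theta U)%:E *
    \int[P]_w mc_dist A (prior_fun U) w)%E).
  apply: integral_le_weighted_sum.
  - exact: measurableT.
  - by move=> U; exact: bern_ge0.
  - by move=> U; apply: mA; exact: prior_fun_Fmon.
  - by move=> U w _; apply: integral_ge0 => z _; rewrite lee_fin.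
  - exact: measurable_cst.
  - by move=> w _; rewrite lee_fin.
  - by move=> w _; exact: det_error_ge.
have E0 : (0 <= mc_error P A)%E.
  apply: (@le_trans _ _ (\int[P]_w mc_dist A (prior_fun [ffun=> true]) w)%E).
    by apply: integral_ge0 => w _; apply: integral_ge0 => z _; rewrite lee_fin.
  apply: ereal_sup_ubound; exists (prior_fun [ffun=> true]) => //.
  exact: prior_fun_Fmon.
apply: (@le_trans _ _ (\sum_U (bern theta U)%:E * mc_error P A)%E).
  apply: lee_sum => U _; apply: lee_wpmul2l; first by rewrite lee_fin bern_ge0.
  by apply: ereal_sup_ubound; exists (prior_fun U) => //; exact: prior_fun_Fmon.
rewrite -ge0_sume_distrl ?sumEFin ?sum_bern ?mul1e// => U _.
by rewrite lee_fin bern_ge0.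
Qed.

End Prior.

(** * The bound on the Monte Carlo complexity *)

(** Strictness survives the infimum because naturals above [x] are at least the truncation of [x]
    plus one. *)
Lemma lt_ereal_inf_nat (R : realType) (S : set nat) (x : R) : 0 <= x ->
  (forall n, S n -> x < n%:R) -> (x%:E < ereal_inf [set n%:R%:E | n in S])%E.
Proof.
move=> x0 xS; have /andP[_ xm] := truncn_itv x0.
apply: (@lt_le_trans _ _ (Num.truncn x).+1%:R%:E); first by rewrite lte_fin.
apply: le_ereal_inf_tmp => _ [n /xS xn <-]; rewrite lee_fin ler_nat.
by rewrite -(ltr_nat R) (le_lt_trans _ xn)// truncn_le.
Qed.

Lemma n_ran_gt (R : realType) (d : nat) (eps : R) : (100 <= d)%N ->
  15^-1 * Num.sqrt (100 / d%:R) <= eps <= 15^-1 ->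
  ((108 * expR (Num.sqrt d%:R / (15 * eps) - Num.sqrt 100))%:E < n_ran eps d)%E.
Proof.
move=> d100 /andP[eps_ge eps_le].
have s100 : Num.sqrt 100 = 10 :> R.
  by rewrite (_ : 100 = 10 ^+ 2) ?sqrtr_sqr ?ger0_norm// expr2; lra.
have d0 : 0 < d%:R :> R by rewrite ltr0n; apply: leq_trans d100.
have r0 : 0 < Num.sqrt d%:R :> R by rewrite sqrtr_gt0.
(* The lower end of the admissible range of [eps], with 2/3 = 10/15. *)
have Y1 : 2 / 3 <= eps * Num.sqrt d%:R.
  rewrite -ler_pdivrMr//; apply: le_trans eps_ge.
  by rewrite sqrtrM// s100 sqrtrV ?(ltW d0)// mulrA ler_pM2r ?invr_gt0//; lra.
have eps0 : 0 < eps by rewrite -(pmulr_lgt0 eps r0); apply: lt_le_trans Y1; lra.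
have [t [theta [th01 H]]] := undetected_lower_bound _ d100 Y1 (ltac:(lra)).
rewrite s100; apply: lt_ereal_inf_nat ; first by rewrite mulr_ge0// expR_ge0.
move=> n [disp [Om [P [A [mA]]]]].
move=> err; rewrite ltNge; apply/negP => /H[c eps_c cu].
move: err; rewrite leNgt => /negP; apply.
by apply: (mc_error_gt _ _ _ _ _ _ _ _ _ th01 eps_c cu) => //; lra.
Qed.

Theorem theorem4p1 (R : realType) :
  (exists (sigma0 nu eps0 : R) (d0 : nat),
     [/\ 0 < sigma0, 0 < nu, 0 < eps0, (0 < d0)%N &
       (forall d : nat, (d0 <= d)%N ->
          ((nu * expR (sigma0 * Num.sqrt d%:R))%:E < n_ran eps0 d)%E) /\
       (forall (d : nat) (eps : R), (d0 <= d)%N ->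
          eps0 * Num.sqrt (d0%:R / d%:R) <= eps <= eps0 ->
          let c := sigma0 * eps0 in
          ((nu * expR (c * (Num.sqrt d%:R / eps)))%:E < n_ran eps d)%E)]) /\
  (forall d : nat, (100 <= d)%N ->
     ((108 * expR (Num.sqrt d%:R - Num.sqrt 100))%:E < n_ran (15^-1 : R) d)%E) /\
  ((108 : R)%:E < n_ran (15^-1 : R) 100)%E /\
  (forall (d : nat) (eps : R), (100 <= d)%N ->
     15^-1 * Num.sqrt (100 / d%:R) <= eps <= 15^-1 ->
     ((108 * expR (Num.sqrt d%:R / (15 * eps) - Num.sqrt 100))%:E
        < n_ran eps d)%E).
Proof.
have max_eps (d : nat) : (100 <= d)%N ->
    ((108 * expR (Num.sqrt d%:R - Num.sqrt 100))%:E < n_ran (15^-1 : R) d)%E.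
  move=> d100; have := @n_ran_gt R d 15^-1 d100.
  rewrite mulfV ?pnatr_eq0// divr1; apply; rewrite lexx andbT.
  have d0 : 0 < d%:R :> R by rewrite ltr0n; apply: leq_trans d100.
  rewrite ler_piMr ?invr_ge0// -[leRHS]sqrtr1 ler_wsqrtr//.
  by rewrite ler_pdivrMr// mul1r ler_nat.
split; last first.
  split=> //; split; last by move=> d eps; exact: n_ran_gt.
  by have := max_eps 100 isT; rewrite subrr expR0 mulr1.
have e0 : 0 < 108 * expR (- Num.sqrt 100) :> R by rewrite mulr_gt0 ?expR_gt0.
(* The explicit bounds supply the constants: exp(-sqrt 100) moves into [nu], and c = 1/15. *)
exists 1, (108 * expR (- Num.sqrt 100)), 15^-1, 100; split=> //.
split=> [d d100|d eps d100 eps_itv /=].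
  by rewrite mul1r -mulrA -expRD addrC max_eps.
rewrite mul1r -mulrA -expRD addrC.
by rewrite mulrCA -invfM n_ran_gt.
Qed.
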